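(* Let $Q$ be a residually finite quandle. If for each $n \geq 1$, $Q$ has only finitely many congruences of index $n$, then $Q$ is Hopfian.
   Context: A quandle is a non-empty set $Q$ with a binary operation $*$ such that (Q1) $x*x=x$ for all $x\in Q$; (Q2) for all $x,y\in Q$ there is a unique $z\in Q$ with $x=z*y$ (write $z=x*^{-1}y$); (Q3) $(x*y)*z=(x*z)*(y*z)$ for all $x,y,z\in Q$. A homomorphism of quandles is a map preserving $*$. A quandle $Q$ is residually finite if for any distinct $a,b\in Q$ there exist a finite quandle $F$ and a homomorphism $f:Q\to F$ with $f(a)\neq f(b)$. A congruence on $Q$ is an equivalence relation on $Q$ compatible with both $*$ and $*^{-1}$; its index is the cardinality of the quotient quandle $Q/\alpha$. A quandle $Q$ is Hopfian if every surjective quandle endomorphism of $Q$ is an automorphism. *)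

(* Defs.v *)
From HB Require Import structures.
From mathcomp Require Import all_boot.
From mathcomp Require Import boolp classical_sets functions cardinality.

Set Implicit Arguments.
Unset Strict Implicit.
Unset Printing Implicit Defensive.

Declare Scope quandle_scope.
Delimit Scope quandle_scope with Qd.

Local Open Scope classical_set_scope.

HB.mixin Record isQuandle T := {
  qop : T -> T -> T;
  quandle_inhabited : inhabited T;
  qop_id : forall x : T, qop x x = x;
  qop_uniq_div : forall x y : T, exists! z : T, x = qop z y;
  qop_distr : forall x y z : T, qop (qop x y) z = qop (qop x z) (qop y z)
}.

#[short(type="quandleType")]
HB.structure Definition Quandle := { T of isQuandle T }.

Notation "x *q y" := (qop x y)
  (at level 40, left associativity) : quandle_scope.
Local Open Scope quandle_scope.

Lemma qop_div_ex (Q : quandleType) (x y : Q) : exists z : Q, x = z *q y.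
Proof. by have [z [xE _]] := qop_uniq_div x y; exists z. Qed.

Definition qdiv (Q : quandleType) (x y : Q) : Q :=
  projT1 (cid (qop_div_ex x y)).

Notation "x /q y" := (qdiv x y)
  (at level 40, left associativity) : quandle_scope.

Lemma qdivK (Q : quandleType) (x y : Q) : (x /q y) *q y = x.
Proof. by rewrite /qdiv; case: cid. Qed.

Lemma qopK (Q : quandleType) (x y : Q) : (x *q y) /q y = x.
Proof.
have [z [_ zU]] := qop_uniq_div (x *q y) y.
exact: etrans (esym (zU _ (esym (qdivK (x *q y) y)))) (zU x erefl).
Qed.

Definition quandle_hom (Q S : quandleType) (f : Q -> S) : Prop :=
  forall x y : Q, f (x *q y) = f x *q f y.

Definition quandle_automorphism (Q : quandleType) (f : Q -> Q) : Prop :=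
  quandle_hom f /\ bijective f.

Definition residually_finite (Q : quandleType) : Prop :=
  forall a b : Q, a <> b ->
    exists (F : quandleType) (f : Q -> F),
      [/\ finite_set [set: F], quandle_hom f & f a <> f b].

Definition hopfian (Q : quandleType) : Prop :=
  forall f : Q -> Q, quandle_hom f -> set_surj [set: Q] [set: Q] f ->
    quandle_automorphism f.

(* By proof irrelevance and extensionality, two congruences are equal as soon
   as their underlying relations are (see congruence_eqP), so counting elements
   of this type counts relations. *)
Record congruence (Q : quandleType) := Congruence {
  congr_rel :> Q -> Q -> Prop;
  congr_equiv : RelationClasses.Equivalence congr_rel;
  congr_op : forall x x' y y' : Q,
    congr_rel x x' -> congr_rel y y' -> congr_rel (x *q y) (x' *q y');
  congr_div : forall x x' y y' : Q,
    congr_rel x x' -> congr_rel y y' -> congr_rel (x /q y) (x' /q y')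
}.

Lemma congruence_eqP (Q : quandleType) (a b : congruence Q) :
  (forall x y : Q, a x y <-> b x y) -> a = b.
Proof.
move=> ab; have : congr_rel a = congr_rel b.
  by apply/funext => x; apply/funext => y; apply/propext.
case: a b {ab} => [r e o d] [r' e' o' d'] /= rr'.
by subst r'; congr Congruence; apply: Prop_irrelevance.
Qed.

Definition quotient (Q : quandleType) (a : congruence Q) : Type :=
  {C : set Q | exists x : Q, C = [set y | a x y]}.

Section Quotient.
Variables (Q : quandleType) (a : congruence Q).

Definition quotient_pi (x : Q) : quotient a :=
  exist _ [set y | a x y] (ex_intro _ x erefl).

Definition quotient_repr (C : quotient a) : Q := projT1 (cid (proj2_sig C)).

Lemma quotient_reprK (C : quotient a) : quotient_pi (quotient_repr C) = C.
Proof.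
rewrite /quotient_repr; case: cid => x /=; case: C => C CP /= CE.
by apply: eq_exist; rewrite CE.
Qed.

Lemma quotient_piP (x y : Q) : quotient_pi x = quotient_pi y <-> a x y.
Proof.
have [ar as_ at_] := congr_equiv a; split=> [[] E | axy].
  by have : [set z | a x z] y by rewrite E; exact: ar.
apply: eq_exist; apply/funext => z; apply/propext; split => /= h.
  exact: at_ (as_ _ _ axy) h.
exact: at_ axy h.
Qed.

Definition quotient_op (C D : quotient a) : quotient a :=
  quotient_pi (quotient_repr C *q quotient_repr D).

Lemma quotient_opE (x y : Q) :
  quotient_op (quotient_pi x) (quotient_pi y) = quotient_pi (x *q y).
Proof.
by apply/quotient_piP; apply: congr_op; apply/quotient_piP;
  exact: quotient_reprK.
Qed.

Lemma quotient_inhabited : inhabited (quotient a).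
Proof. by have [x] := @quandle_inhabited Q; split; exact: quotient_pi x. Qed.

Lemma quotient_op_id (C : quotient a) : quotient_op C C = C.
Proof. by rewrite -(quotient_reprK C) quotient_opE qop_id. Qed.

Lemma quotient_op_uniq_div (C D : quotient a) :
  exists! E : quotient a, C = quotient_op E D.
Proof.
rewrite -(quotient_reprK C) -(quotient_reprK D).
move: (quotient_repr C) (quotient_repr D) => x y.
exists (quotient_pi (x /q y)); split=> [|E]; first by rewrite quotient_opE qdivK.
rewrite -(quotient_reprK E) quotient_opE => /quotient_piP axy.
apply/quotient_piP; rewrite -[X in a _ X](qopK _ y); apply: congr_div => //.
by have [ar _ _] := congr_equiv a; exact: ar.
Qed.

Lemma quotient_op_distr (C D E : quotient a) :
  quotient_op (quotient_op C D) E =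
  quotient_op (quotient_op C E) (quotient_op D E).
Proof.
rewrite -(quotient_reprK C) -(quotient_reprK D) -(quotient_reprK E).
by rewrite !quotient_opE qop_distr.
Qed.

HB.instance Definition _ := isQuandle.Build (quotient a)
  quotient_inhabited quotient_op_id quotient_op_uniq_div quotient_op_distr.

Lemma quotient_pi_hom : quandle_hom quotient_pi.
Proof. by move=> x y; rewrite [RHS]quotient_opE. Qed.

End Quotient.

Definition has_index (Q : quandleType) (a : congruence Q) (n : nat) : Prop :=
  ([set: quotient a] #= `I_n)%card.

(* Main.v *)
Require Import Defs.
From HB Require Import structures.
From mathcomp Require Import all_boot.
From mathcomp Require Import boolp classical_sets functions cardinality.

(** The argument is the quandle version of Malcev's theorem for groups.  Let
    [f] be a surjective endomorphism of [Q].  Pulling a congruence [a] back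
    along [f] gives a congruence [comap f a] whose quotient is in bijection with
    that of [a], so pulling back maps the set of congruences of index [n] to
    itself; surjectivity of [f] also makes it injective.  As this set is finite,
    pulling back is a permutation of it ([finite_inj_surj]): every congruence of
    finite index is pulled back along [f], hence relates any two points that
    [f] identifies ([finite_index_related]).

    If now [f a = f b] with [a <> b], residual finiteness gives a homomorphism
    [g] to a finite quandle with [g a <> g b].  The kernel of [g] is a congruence
    of finite index, so it relates [a] and [b], that is [g a = g b], a
    contradiction. *)

Set Implicit Arguments.
Unset Strict Implicit.
Unset Printing Implicit Defensive.

Local Open Scope classical_set_scope.
Local Open Scope quandle_scope.

(** Were [y] outside the image, injectivity would make the orbit of [y] under
    [h] an infinite sequence of distinct points of [A]. *)
Lemma finite_inj_surj (T : Type) (A : set T) (h : T -> T) :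
  finite_set A -> injective h -> (forall x, A x -> A (h x)) ->
  forall y, A y -> exists2 x, A x & h x = y.
Proof.
move=> finA h_inj hA y Ay; apply: contrapT => y_nim.
have Aiter k : A (iter k h y) by elim: k => [//|k IHk]; exact: hA.
have iter_inj : injective (fun k => iter k h y).
  elim=> [|i IHi] [|j] //= E.
  - by case: y_nim; exists (iter j h y); [exact: Aiter | rewrite -E].
  - by case: y_nim; exists (iter i h y); [exact: Aiter | rewrite E].
  - by rewrite (IHi j) //; exact: h_inj.
apply: (finite_setPn A).1 finA _.
have range_card : (range (fun k => iter k h y) #= [set: nat])%card.
  by apply: inj_card_eq => i j _ _; exact: iter_inj.
rewrite -(card_le_eql range_card).
by apply: subset_card_le => _ [k _ <-]; exact: Aiter.
Qed.

Lemma quandle_hom_div (Q S : quandleType) (f : Q -> S) : quandle_hom f ->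
  forall x y : Q, f (x /q y) = f x /q f y.
Proof. by move=> f_hom x y; rewrite -{2}(qdivK x y) f_hom qopK. Qed.

Section Comap.
Variables (Q S : quandleType) (f : Q -> S) (f_hom : quandle_hom f).
Variable a : congruence S.

Let comap_equiv : RelationClasses.Equivalence (fun x y => a (f x) (f y)).
Proof.
have [ar as_ at_] := congr_equiv a.
by split=> [x|x y|x y z]; [exact: ar | exact: as_ | exact: at_].
Qed.

Let comap_op (x x' y y' : Q) :
  a (f x) (f x') -> a (f y) (f y') -> a (f (x *q y)) (f (x' *q y')).
Proof. by rewrite !f_hom; exact: congr_op. Qed.

Let comap_div (x x' y y' : Q) :
  a (f x) (f x') -> a (f y) (f y') -> a (f (x /q y)) (f (x' /q y')).
Proof. by rewrite !(quandle_hom_div f_hom); exact: congr_div. Qed.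

Definition comap : congruence Q := Congruence comap_equiv comap_op comap_div.

(** The injection of the quotient by a pullback into the quotient by [a] that
    [f] induces on classes; it controls the index of the pullback. *)
Definition comap_quotient (C : quotient comap) : quotient a :=
  quotient_pi a (f (quotient_repr C)).

Lemma comap_quotient_pi (x : Q) :
  comap_quotient (quotient_pi comap x) = quotient_pi a (f x).
Proof.
by apply/quotient_piP; apply/(quotient_piP comap); exact: quotient_reprK.
Qed.

Lemma comap_quotient_inj : injective comap_quotient.
Proof.
move=> C D /quotient_piP CD.
by rewrite -(quotient_reprK C) -(quotient_reprK D); apply/quotient_piP.
Qed.

Lemma comap_quotient_card : (range comap_quotient #= [set: quotient comap])%card.
Proof. by apply: inj_card_eq => C D _ _; exact: comap_quotient_inj. Qed.

Lemma has_index_comap (n : nat) : set_surj [set: Q] [set: S] f ->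
  has_index a n -> has_index comap n.
Proof.
rewrite /has_index => f_surj an; rewrite -(card_eql comap_quotient_card).
suff -> : range comap_quotient = [set: quotient a] by [].
apply/seteqP; split=> // C _.
have [x _ fx] := f_surj (quotient_repr C) I.
exists (quotient_pi comap x) => //.
by rewrite comap_quotient_pi fx quotient_reprK.
Qed.

End Comap.

Lemma comap_inj (Q S : quandleType) (f : Q -> S) (f_hom : quandle_hom f) :
  set_surj [set: Q] [set: S] f -> injective (comap f_hom).
Proof.
move=> f_surj a b ab; apply: congruence_eqP => u v.
have [x _ <-] := f_surj u I; have [y _ <-] := f_surj v I.
by rewrite -[a _ _]/(comap f_hom a x y) ab.
Qed.

Definition eq_congruence (Q : quandleType) : congruence Q :=
  Congruence RelationClasses.eq_equivalence
    (@f_equal2 _ _ _ (@qop Q)) (@f_equal2 _ _ _ (@qdiv Q)).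

(** The kernel of a homomorphism is the pullback of equality, so its quotient
    embeds in the target. *)
Lemma has_index_kernel (Q F : quandleType) (g : Q -> F) (g_hom : quandle_hom g) :
  finite_set [set: F] ->
  exists2 n, (1 <= n)%N & has_index (comap g_hom (eq_congruence F)) n.
Proof.
move=> finF; set k := comap _ _.
have fink : finite_set [set: quotient k].
  rewrite -(eq_finite_set (comap_quotient_card g_hom (eq_congruence F))).
  apply: (@sub_finite_set _ _ (quotient_pi (eq_congruence F) @` [set: F])).
    by move=> _ [C _ <-]; exists (g (quotient_repr C)).
  exact: finite_image.
(* Index 0 is excluded because a quandle, hence its quotient, is inhabited. *)
have [[|n] kn] := (finite_setP _).1 fink; last by exists n.+1.
have [x] := @quandle_inhabited Q.
move: kn; rewrite II0 card_eq0 => /eqP k0.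
by have : [set: quotient k] (quotient_pi k x) by []; rewrite k0.
Qed.

(** As [k] is the pullback along [f] of some congruence [c] of the same index,
    [k a b] unfolds to [c (f a) (f b)], an instance of reflexivity. *)
Lemma finite_index_related (Q : quandleType) (f : Q -> Q) (n : nat)
    (k : congruence Q) (a b : Q) :
  quandle_hom f -> set_surj [set: Q] [set: Q] f ->
  finite_set [set c : congruence Q | has_index c n] ->
  has_index k n -> f a = f b -> k a b.
Proof.
move=> f_hom f_surj fin_n kn fab.
have [c _ <-] : exists2 c, has_index c n & comap f_hom c = k.
  apply: finite_inj_surj fin_n _ _ k kn; first exact: comap_inj.
  by move=> c /=; exact: has_index_comap.
rewrite /= fab; have [cr _ _] := congr_equiv c; exact: cr.
Qed.

Theorem proposition2p2 (Q : quandleType)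
  (Q_rf : residually_finite Q)
  (Q_fin_index : forall n : nat, (1 <= n)%N ->
     finite_set [set a : congruence Q | has_index a n]) :
  hopfian Q.
Proof.
move=> f f_hom f_surj; split=> //; rewrite -setTT_bijective; split=> //.
move=> a b _ _ fab; apply: contrapT => ab.
have [F [g [finF g_hom]]] := Q_rf a b ab; apply.
have [n n_gt0 kn] := has_index_kernel g_hom finF.
exact: finite_index_related f_hom f_surj (Q_fin_index _ n_gt0) kn fab.
Qed.
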